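(* Let $A,B$ be finite-dimensional systems and let $\rho_{AB}$ be a separable state, i.e. $\rho_{AB}=\sum_x p(x)\,\sigma^x_A\otimes\tau^x_B$ for some probability distribution $\{p(x)\}_x$ and sets of states $\{\sigma^x_A\}_x\subset\mathfrak{D}(A)$, $\{\tau^x_B\}_x\subset\mathfrak{D}(B)$. Then $\mathbf{H}(A|B)_\rho\ge 0$ for every quantum conditional entropy $\mathbf{H}$.
   Context: All systems (Hilbert spaces) are finite-dimensional; $|A|$ is the dimension of $A$, $\mathfrak{D}(A)$ the set of density operators on $A$, $I_A$ the identity, $\mathbf{u}_A=I_A/|A|$ the uniform state. A quantum channel is a completely positive trace-preserving linear map; an isometric channel is one of the form $(\cdot)\mapsto U(\cdot)U^\dagger$ with $U^\dagger U=I$. Maps act as the identity on systems not mentioned. Conditionally unital channel: $\mathcal{N}_{AB\to AB'}$ such that for every $\rho_B\in\mathfrak{D}(B)$ there is $\sigma_{B'}\in\mathfrak{D}(B')$ with $\mathcal{N}(\mathbf{u}_A\otimes\rho_B)=\mathbf{u}_A\otimes\sigma_{B'}$. $A\not\to B'$ semi-causal channel: $\mathcal{N}_{AB\to AB'}$ such that $\operatorname{Tr}_A\circ\mathcal{N}\circ\mathcal{M}_A=\operatorname{Tr}_A\circ\mathcal{N}$ for every channel $\mathcal{M}_A$ from $A$ to $A$. Conditionally mixing channel: a channel $\mathcal{N}_{AB\to AB'}$ that is both conditionally unital and $A\not\to B'$ semi-causal. Conditional majorization: $\rho_{AB}\succ_A\sigma_{A'B'}$ if there exist a system $A''$ with $|A''|\ge\max\{|A|,|A'|\}$,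 isometric channels $\mathcal{V}_{A\to A''}$, $\mathcal{U}_{A'\to A''}$, and a conditionally mixing channel $\mathcal{N}_{A''B\to A''B'}$ with $\mathcal{U}_{A'\to A''}(\sigma_{A'B'})=(\mathcal{N}_{A''B\to A''B'}\circ\mathcal{V}_{A\to A''})(\rho_{AB})$. Quantum conditional entropy: a function $\mathbf{H}:\bigcup_{A,B}\mathfrak{D}(AB)\to\mathbb{R}$ (value at $\rho_{AB}$ written $\mathbf{H}(A|B)_\rho$; one-dimensional systems allowed) that is not the zero function when $|B|=1$ and satisfies, for all systems and states: (1) monotonicity: $\rho_{AB}\succ_A\sigma_{A'B'}\Rightarrow\mathbf{H}(A|B)_\rho\le\mathbf{H}(A'|B')_\sigma$; (2) additivity: $\mathbf{H}(AA'|BB')_{\rho\otimes\sigma}=\mathbf{H}(A|B)_\rho+\mathbf{H}(A'|B')_\sigma$. *)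

(* Defs.v *)
From HB Require Import structures.
From mathcomp Require Import all_boot all_order all_algebra.
From mathcomp Require Import sesquilinear spectral reals.
From mathcomp Require Import complex mxtens.

Set Implicit Arguments.
Unset Strict Implicit.
Unset Printing Implicit Defensive.

Import Order.TTheory GRing.Theory Num.Theory.
Local Open Scope ring_scope.
Local Open Scope sesquilinear_scope.
Local Open Scope complex_scope.

(* A system of dimension n is C^n with C = R[i], R a realType, and an operator
   on it is a matrix 'M[C]_n.  The composite of systems of dimensions a and b
   has dimension a * b, with basis vectors mxtens_index (i, j), i : 'I_a,
   j : 'I_b; the tensor product of operators is the Kronecker product *t.
   Dimension 0 is not excluded syntactically, but it carries no density
   operator, since the trace of a 0 x 0 matrix is 0. *)

Section States.
Variable R : realType.
Local Notation C := R[i].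

(* In the order of C, 0 <= z says that z is real and nonnegative, so this
   condition includes hermiticity of X. *)
Definition psd n (X : 'M[C]_n) : Prop :=
  forall v : 'cV[C]_n, 0 <= (v^t* *m X *m v) 0 0.

Definition density n (rho : 'M[C]_n) : Prop := psd rho /\ \tr rho = 1.

Definition uniform n : 'M[C]_n := (n%:R^-1)%:M.

Definition separable a b (rho : 'M[C]_(a * b)) : Prop :=
  exists (k : nat) (p : 'I_k -> R)
         (sigma : 'I_k -> 'M[C]_a) (tau : 'I_k -> 'M[C]_b),
    [/\ forall x, 0 <= p x, \sum_x p x = 1,
        forall x, density (sigma x), forall x, density (tau x)
      & rho = \sum_x (p x)%:C *: (sigma x *t tau x)].

(* Partial trace over the first tensor factor. *)
Definition ptrace1 a b (X : 'M[C]_(a * b)) : 'M[C]_b :=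
  \matrix_(i, j) \sum_(k < a) X (mxtens_index (k, i)) (mxtens_index (k, j)).

(* N acting on the first tensor factor and the identity on the second: the
   operator N (x) id.  Entry ((s, i), (t, j)) of the image is the entry (s, t)
   of N applied to the (i, j) block of X. *)
Definition act1 m n k (N : 'M[C]_m -> 'M[C]_n) (X : 'M[C]_(m * k)) :
    'M[C]_(n * k) :=
  \matrix_(i, j)
    N (\matrix_(s, t) X (mxtens_index (s, (mxtens_unindex i).2))
                        (mxtens_index (t, (mxtens_unindex j).2)))
      (mxtens_unindex i).1 (mxtens_unindex j).1.

(* The reordering A B A' B' -> A A' B B' of tensor factors. *)
Definition regroup_index a b a' b' (i : 'I_((a * a') * (b * b'))) :
    'I_((a * b) * (a' * b')) :=
  let x := mxtens_unindex (mxtens_unindex i).1 in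
  let y := mxtens_unindex (mxtens_unindex i).2 in
  mxtens_index (mxtens_index (x.1, y.1), mxtens_index (x.2, y.2)).

Definition regroup a b a' b' (X : 'M[C]_((a * b) * (a' * b'))) :
    'M[C]_((a * a') * (b * b')) :=
  mxsub (@regroup_index a b a' b') (@regroup_index a b a' b') X.

Lemma act1_tens m n k (N : 'M[C]_m -> 'M[C]_n) (X : 'M[C]_m) (Y : 'M[C]_k) :
  linear N -> act1 N (X *t Y) = N X *t Y.
Proof.
move=> linN.
have N0 : N 0 = 0 by rewrite -[X in N X](addNr 0) -scaleN1r linN scaleN1r addNr.
have NZ c Z : N (c *: Z) = c *: N Z by rewrite -[c *: Z]addr0 linN N0 addr0.
apply/matrixP => i j; rewrite [RHS]mxE mulrC mxE.
rewrite [X in N X](_ : _ =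
  Y (mxtens_unindex i).2 (mxtens_unindex j).2 *: X) ?NZ ?mxE //.
by apply/matrixP => s t; rewrite !mxE !mxtens_indexK mulrC.
Qed.

Lemma regroup_tens a b a' b' (X : 'M[C]_a) (Y : 'M[C]_b)
    (X' : 'M[C]_a') (Y' : 'M[C]_b') :
  regroup ((X *t Y) *t (X' *t Y')) = (X *t X') *t (Y *t Y').
Proof.
by apply/matrixP => i j; rewrite !mxE !mxtens_indexK /= mulrACA.
Qed.

End States.

Section Channels.
Variable R : realType.
Local Notation C := R[i].

Definition completely_positive m n (N : 'M[C]_m -> 'M[C]_n) : Prop :=
  forall (k : nat) (X : 'M[C]_(m * k)), psd X -> psd (act1 N X).

Definition trace_preserving m n (N : 'M[C]_m -> 'M[C]_n) : Prop :=
  forall X : 'M[C]_m, \tr (N X) = \tr X.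

Definition channel m n (N : 'M[C]_m -> 'M[C]_n) : Prop :=
  [/\ linear N, completely_positive N & trace_preserving N].

Definition isometric_channel m n (V : 'M[C]_m -> 'M[C]_n) : Prop :=
  exists U : 'M[C]_(n, m),
    U^t* *m U = 1%:M /\ forall X, V X = U *m X *m U^t*.

Definition conditionally_unital a b b' (N : 'M[C]_(a * b) -> 'M[C]_(a * b')) :
    Prop :=
  forall rho : 'M[C]_b, density rho ->
    exists sigma : 'M[C]_b',
      density sigma /\ N (uniform R a *t rho) = uniform R a *t sigma.

(* No signalling from the input A to the output B'. *)
Definition semicausal a b b' (N : 'M[C]_(a * b) -> 'M[C]_(a * b')) : Prop :=
  forall M : 'M[C]_a -> 'M[C]_a, channel M ->
    forall X : 'M[C]_(a * b), ptrace1 (N (act1 M X)) = ptrace1 (N X).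

Definition conditionally_mixing a b b' (N : 'M[C]_(a * b) -> 'M[C]_(a * b')) :
    Prop :=
  [/\ channel N, conditionally_unital N & semicausal N].

Definition cond_majorizes a b a' b'
    (rho : 'M[C]_(a * b)) (sigma : 'M[C]_(a' * b')) : Prop :=
  exists (a'' : nat) (V : 'M[C]_a -> 'M[C]_a'') (U : 'M[C]_a' -> 'M[C]_a'')
         (N : 'M[C]_(a'' * b) -> 'M[C]_(a'' * b')),
    [/\ (maxn a a' <= a'')%N, isometric_channel V, isometric_channel U,
        conditionally_mixing N
      & act1 U sigma = N (act1 V rho)].

End Channels.

(* H a b rho is the value H(A|B)_rho for |A| = a, |B| = b.  Only its values on
   density operators are constrained or used. *)
Record quantum_cond_entropy (R : realType)
    (H : forall a b : nat, 'M[R[i]]_(a * b) -> R) : Prop := {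
  qce_nonzero : exists (a : nat) (rho : 'M[R[i]]_(a * 1)),
    density rho /\ H a 1%N rho <> 0;
  qce_monotone : forall (a b a' b' : nat)
      (rho : 'M[R[i]]_(a * b)) (sigma : 'M[R[i]]_(a' * b')),
    density rho -> density sigma -> cond_majorizes rho sigma ->
    H a b rho <= H a' b' sigma;
  qce_additive : forall (a b a' b' : nat)
      (rho : 'M[R[i]]_(a * b)) (sigma : 'M[R[i]]_(a' * b')),
    density rho -> density sigma ->
    H (a * a')%N (b * b')%N (regroup (rho *t sigma))
      = H a b rho + H a' b' sigma
}.

(* Main.v *)
From HB Require Import structures.
Require Import Defs.
From mathcomp Require Import all_boot all_order all_algebra.
From mathcomp Require Import sesquilinear spectral reals complex mxtens.

(** Additivity forces [H] to vanish on the trivial state [1] of the trivial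
    systems, so by monotonicity it is enough that this state conditionally
    majorizes [rho = \sum_x p x sigma_x (x) tau_x].  Embed it as the basis vector
    [0] of [A], with [B] still trivial, and then measure [A] in its basis: on
    outcome [0] prepare [rho], on any other outcome prepare
    [\sum_x p x (1 - sigma_x) / (|A| - 1) (x) tau_x].  The prepared states sum to
    [1 (x) \sum_x p x tau_x], whence conditional unitality, and they all have the
    same marginal on [B'], whence semicausality. *)

Set Implicit Arguments.
Unset Strict Implicit.
Unset Printing Implicit Defensive.

Import Order.TTheory GRing.Theory Num.Theory.
Local Open Scope ring_scope.
Local Open Scope sesquilinear_scope.
Local Open Scope complex_scope.

(** * Positive semidefinite operators: spectral form and tensor products *)

Section PositiveSemidefinite.
Variable R : realType.
Local Notation C := R[i].

Lemma trmxC_mul m n p (A : 'M[C]_(m, n)) (B : 'M[C]_(n, p)) :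
  (A *m B)^t* = B^t* *m A^t*.
Proof. by rewrite trmx_mul map_mxM. Qed.

Lemma trmxC_tens m n p q (A : 'M[C]_(m, n)) (B : 'M[C]_(p, q)) :
  (A *t B)^t* = A^t* *t B^t*.
Proof. by rewrite trmx_tens map_mxT. Qed.

Lemma tens11 m n : (1%:M : 'M[C]_m) *t (1%:M : 'M[C]_n) = 1%:M.
Proof.
apply/matrixP => r s; case: (mxtens_indexP r) => i k; case: (mxtens_indexP s) => j l.
rewrite tensmxE !mxE (can_eq (@mxtens_indexK _ _)) xpair_eqE.
by rewrite -natrM mulnb.
Qed.

Lemma big_mxtens_index (V : nmodType) m n (F : 'I_(m * n) -> V) :
  \sum_i F i = \sum_i \sum_j F (mxtens_index (i, j)).
Proof.
rewrite pair_bigA /= (reindex (@mxtens_index m n)) /=.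
  by apply: eq_bigr => -[].
by exists (@mxtens_unindex m n) => ? _; rewrite (mxtens_indexK, mxtens_unindexK).
Qed.

Lemma quad_formE n (X : 'M[C]_n) (v : 'cV[C]_n) :
  (v^t* *m X *m v) 0 0 = \sum_i \sum_j (v i 0)^* * X i j * v j 0.
Proof.
rewrite mxE exchange_big; apply: eq_bigr => j _.
by rewrite mxE mulr_suml; apply: eq_bigr => i _; rewrite !mxE.
Qed.

Lemma psdZ n (c : C) (X : 'M[C]_n) : 0 <= c -> psd X -> psd (c *: X).
Proof.
by move=> c0 hX v; rewrite -scalemxAr -scalemxAl mxE mulr_ge0.
Qed.

Lemma psd_sum n (I : finType) (F : I -> 'M[C]_n) :
  (forall i, psd (F i)) -> psd (\sum_i F i).
Proof.
by move=> hF v; rewrite mulmx_sumr mulmx_suml summxE sumr_ge0 // => i _; apply: hF.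
Qed.

Lemma psd_conjmx m n (A : 'M[C]_(m, n)) (X : 'M[C]_m) :
  psd X -> psd (A^t* *m X *m A).
Proof. by move=> hX v; have := hX (A *m v); rewrite trmxC_mul !mulmxA. Qed.

Lemma delta_formE n (X : 'M[C]_n) i j :
  ((delta_mx i 0 : 'cV[C]_n)^t* *m X *m (delta_mx j 0 : 'cV[C]_n)) 0 0 = X i j.
Proof. by rewrite trmx_delta map_delta_mx -rowE -colE !mxE. Qed.

Lemma psd_diag_ge0 n (X : 'M[C]_n) i : psd X -> 0 <= X i i.
Proof. by move=> /(_ (delta_mx i 0)); rewrite delta_formE. Qed.

Lemma psd_diag n (d : 'rV[C]_n) : (forall i, 0 <= d 0 i) -> psd (diag_mx d).
Proof.
move=> hd v; rewrite quad_formE sumr_ge0 // => i _.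
rewrite (bigD1 i) //= big1 ?addr0 => [|j /negPf ji].
  by rewrite mxE eqxx mulr1n mulrAC mulr_ge0 // mulrC mul_conjC_ge0.
by rewrite mxE eq_sym ji mulr0n mulr0 mul0r.
Qed.

Lemma mxDE m n (A B : 'M[C]_(m, n)) i j : (A + B) i j = A i j + B i j.
Proof. exact: mxE. Qed.

Lemma mxZE m n c (A : 'M[C]_(m, n)) i j : (c *: A) i j = c * A i j.
Proof. exact: mxE. Qed.

(** Complex polarization: testing on [e_i + c e_j] leaves only the cross terms, and the choices
    [c = 1] and [c = 'i] make [Z i j + Z j i] and [Z i j - Z j i] both vanish. *)
Lemma quad_form_eq0 n (Z : 'M[C]_n) :
  (forall v : 'cV[C]_n, (v^t* *m Z *m v) 0 0 = 0) -> Z = 0.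
Proof.
move=> hZ; apply/matrixP => i j; rewrite mxE.
have polar c : c * Z i j + c^* * Z j i = 0.
  have := hZ (delta_mx i 0 + c *: delta_mx j 0).
  rewrite [(_ + _)^T]linearD /= map_mxD [(_ *: _)^T]linearZ /= map_mxZ !(mulmxDl, mulmxDr).
  rewrite -!scalemxAr -!scalemxAl !(mxDE, mxZE) !hZ !delta_formE.
  by rewrite !(mulr0, addr0, add0r) addrC.
have := polar 'i; have := polar 1.
rewrite conjC1 !mul1r conjCi mulNr -mulrBr => /addr0_eq <-.
rewrite opprK -mulr2n => /eqP; rewrite mulf_eq0 (negPf (neq0Ci _)) /=.
by rewrite mulrn_eq0 => /eqP.
Qed.

(** Nonnegativity in the order of [C] makes the quadratic form of [X] real, so [X] and its adjoint
    have the same form and polarization identifies them. *)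
Lemma psd_hermitian n (X : 'M[C]_n) : psd X -> X \is hermsymmx.
Proof.
move=> hX; apply/is_hermitianmxP; rewrite expr0 scale1r.
apply/eqP; rewrite -subr_eq0; apply/eqP/quad_form_eq0 => v.
rewrite mulmxBr mulmxBl mxDE [X in _ + X]mxE; apply/eqP; rewrite subr_eq0; apply/eqP.
have /ger0_real/CrealP {1}<- := hX v.
have -> : v^t* *m X^t* *m v = (v^t* *m X *m v)^t*.
  by rewrite !trmxC_mul trmxCK mulmxA.
by rewrite !mxE.
Qed.

Lemma psd_spectral n (X : 'M[C]_n) : psd X ->
  exists (P : 'M[C]_n) (d : 'rV[C]_n),
    [/\ P^t* *m P = 1%:M, forall i, 0 <= d 0 i & X = P^t* *m diag_mx d *m P].
Proof.
move=> hX; have /hermitian_normalmx/orthomx_spectralP := psd_hermitian hX.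
set P := spectralmx X; set d := spectral_diag X.
have Pu : P \is unitarymx by exact: spectral_unitarymx.
rewrite invmx_unitary // => EX.
have PP : P *m P^t* = 1%:M by apply/unitarymxP.
exists P, d; split => //; first exact: mulmx1C.
(* The eigenvalues are the diagonal entries of [X] conjugated into its eigenbasis. *)
move=> i; have := psd_diag_ge0 i (psd_conjmx (P^t*) hX).
by rewrite {1}EX trmxCK !mulmxA PP mul1mx -mulmxA PP mulmx1 mxE eqxx.
Qed.

(** Diagonalizing [X] reduces the claim to [diag_mx d *t Y]. This is block diagonal, so its form at
    [v] is the sum over [i] of [d 0 i] times the form of [Y] at the [i]-th slice of [v]. *)
Lemma psd_tens m n (X : 'M[C]_m) (Y : 'M[C]_n) :
  psd X -> psd Y -> psd (X *t Y).
Proof.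
move=> /psd_spectral[P [d [_ d0 ->]]] hY.
have -> : (P^t* *m diag_mx d *m P) *t Y =
    (P *t 1%:M)^t* *m (diag_mx d *t Y) *m (P *t 1%:M).
  by rewrite trmxC_tens trmx1 map_mx1 !tensmx_mul mul1mx mulmx1.
apply: psd_conjmx => v; rewrite quad_formE big_mxtens_index sumr_ge0 // => i _.
have := mulr_ge0 (d0 i) (hY (\col_k v (mxtens_index (i, k)) 0)).
rewrite quad_formE mulr_sumr; congr (0 <= _); apply: eq_bigr => k _.
rewrite big_mxtens_index (bigD1 i) //= [X in _ + X]big1 ?addr0; last first.
  move=> j ji; rewrite big1 // => l _.
  by rewrite tensmxE mxE eq_sym (negPf ji) mulr0n mul0r mulr0 mul0r.
rewrite mulr_sumr; apply: eq_bigr => l _.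
by rewrite tensmxE !mxE eqxx mulr1n !mulrA [d 0 i * _]mulrC.
Qed.

(** The eigenvalues of [X] are nonnegative and sum to 1, so none exceeds 1. *)
Lemma psd_sub_density n (X : 'M[C]_n) : density X -> psd (1%:M - X).
Proof.
case=> /psd_spectral[P [d [PP d0 ->]]] trX.
have -> : 1%:M - P^t* *m diag_mx d *m P = P^t* *m diag_mx (const_mx 1 - d) *m P.
  by rewrite linearB /= diag_const_mx mulmxBr mulmxBl mulmx1 PP.
apply/psd_conjmx/psd_diag => i; rewrite !mxE subr_ge0.
move: trX; rewrite mxtrace_mulC mulmxA (mulmx1C PP) mul1mx mxtrace_diag => <-.
by rewrite (bigD1 i) //= lerDl sumr_ge0.
Qed.

End PositiveSemidefinite.

(** * Density operators, submatrices and partial trace *)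

Section Densities.
Variable R : realType.
Local Notation C := R[i].

Lemma mxtrace_tens m n (X : 'M[C]_m) (Y : 'M[C]_n) :
  \tr (X *t Y) = \tr X * \tr Y.
Proof.
rewrite /mxtrace big_mxtens_index mulr_suml; apply: eq_bigr => i _.
by rewrite mulr_sumr; apply: eq_bigr => k _; rewrite tensmxE.
Qed.

Lemma density_tens m n (X : 'M[C]_m) (Y : 'M[C]_n) :
  density X -> density Y -> density (X *t Y).
Proof.
move=> [hX tX] [hY tY]; split; first exact: psd_tens.
by rewrite mxtrace_tens tX tY mulr1.
Qed.

Lemma density_mixture k n (p : 'I_k -> R) (X : 'I_k -> 'M[C]_n) :
    (forall x, 0 <= p x) -> \sum_x p x = 1 -> (forall x, density (X x)) ->
  density (\sum_x (p x)%:C *: X x).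
Proof.
move=> p0 p1 hX; split.
  by apply: psd_sum => x; apply: psdZ; [rewrite lecR | case: (hX x)].
rewrite linear_sum /= -[1]/(1%:C) -p1 rmorph_sum; apply: eq_bigr => x _.
by rewrite linearZ /=; case: (hX x) => _ ->; exact: mulr1.
Qed.

Lemma density1 : density (1%:M : 'M[C]_1).
Proof.
split; last by rewrite mxtrace1.
by rewrite -diag_const_mx; apply: psd_diag => i; rewrite mxE ler01.
Qed.

Lemma density_gt0 n (X : 'M[C]_n) : density X -> (0 < n)%N.
Proof.
case: n X => // X [_]; rewrite /mxtrace big_ord0 => /eqP.
by rewrite eq_sym oner_eq0.
Qed.

Lemma density_dim1 (X : 'M[C]_1) : density X -> X = 1%:M.
Proof. by case=> _; rewrite {2}[X]mx11_scalar /mxtrace big_ord1 => ->. Qed.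

Lemma psd_mxsub m n (f : 'I_n -> 'I_m) (X : 'M[C]_m) :
  psd X -> psd (mxsub f f X).
Proof.
have -> : mxsub f f X = (colsub f 1%:M)^t* *m X *m colsub f 1%:M.
  rewrite trmx_mxsub map_mxsub trmx1 map_mx1 -mulmxA mulmx_colsub mulmx1.
  by rewrite mul_rowsub_mx mul1mx; apply/matrixP => i j; rewrite !mxE.
exact: psd_conjmx.
Qed.

Lemma ptrace1_linear a b : linear (@ptrace1 R a b).
Proof.
move=> c X Y; apply/matrixP => i j; rewrite !mxE mulr_sumr -big_split /=.
by apply: eq_bigr => k _; rewrite !mxE.
Qed.

HB.instance Definition _ a b :=
  GRing.isLinear.Build C 'M[C]_(a * b) 'M[C]_b _ (@ptrace1 R a b)
    (@ptrace1_linear a b).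

Lemma ptrace1_tens a b (X : 'M[C]_a) (Y : 'M[C]_b) :
  ptrace1 (X *t Y) = \tr X *: Y.
Proof.
apply/matrixP => i j; rewrite !mxE mulr_suml; apply: eq_bigr => k _.
by rewrite tensmxE.
Qed.

Lemma mxtrace_act1 m n k (N : 'M[C]_m -> 'M[C]_n) (X : 'M[C]_(m * k)) :
  trace_preserving N -> \tr (act1 N X) = \tr X.
Proof.
move=> trN; rewrite /mxtrace !big_mxtens_index exchange_big [RHS]exchange_big.
apply: eq_bigr => l _ /=.
pose Y := \matrix_(s, t) X (mxtens_index (s, l)) (mxtens_index (t, l)).
transitivity (\tr (N Y)); last first.
  by rewrite trN; apply: eq_bigr => s _; rewrite mxE.
by apply: eq_bigr => s _; rewrite mxE !mxtens_indexK.
Qed.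

End Densities.

(** * Measure-and-prepare channels *)

Section MeasurePrepare.
Variable R : realType.
Local Notation C := R[i].

Definition measure_prepare m n (S : 'I_m -> 'M[C]_n) (X : 'M[C]_m) : 'M[C]_n :=
  \sum_j X j j *: S j.

Lemma measure_prepare_linear m n (S : 'I_m -> 'M[C]_n) :
  linear (measure_prepare S).
Proof.
move=> c X Y; rewrite /measure_prepare scaler_sumr -big_split /=.
by apply: eq_bigr => j _; rewrite !mxE scalerDl scalerA.
Qed.

(** In this form complete positivity is visible: each summand tensors a prepared state with a
    diagonal block of [X], which is positive as a principal submatrix. *)
Lemma act1_measure_prepare m n k (S : 'I_m -> 'M[C]_n) (X : 'M[C]_(m * k)) :
  act1 (measure_prepare S) X =
  \sum_j S j *t mxsub (fun i => mxtens_index (j, i))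
                      (fun i => mxtens_index (j, i)) X.
Proof.
apply/matrixP => r s; rewrite !(mxE, summxE); apply: eq_bigr => j _.
by rewrite !mxE mulrC.
Qed.

Lemma measure_prepare_channel m n (S : 'I_m -> 'M[C]_n) :
  (forall j, density (S j)) -> channel (measure_prepare S).
Proof.
move=> hS; split; first exact: measure_prepare_linear.
- move=> k X hX; rewrite act1_measure_prepare; apply: psd_sum => j.
  by apply: psd_tens; [case: (hS j) | exact: psd_mxsub].
- move=> X; rewrite linear_sum; apply: eq_bigr => j _.
  by rewrite linearZ /=; case: (hS j) => _ ->; rewrite mulr1.
Qed.

(** With a common marginal [tau], the output marginal depends on the input only through its trace,
    which [act1 M] preserves. *)
Lemma measure_prepare_semicausal a b b' (S : 'I_(a * b) -> 'M[C]_(a * b'))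
    (tau : 'M[C]_b') :
  (forall j, ptrace1 (S j) = tau) -> semicausal (measure_prepare S).
Proof.
move=> hS M [_ _ trM] X.
have E Z : ptrace1 (measure_prepare S Z) = \tr Z *: tau.
  rewrite linear_sum scaler_suml; apply: eq_bigr => j _.
  by rewrite linearZ /= hS.
by rewrite !E mxtrace_act1.
Qed.

Lemma measure_prepare_conditionally_unital a b'
    (S : 'I_(a * 1) -> 'M[C]_(a * b')) (tau : 'M[C]_b') :
  density tau -> \sum_j S j = 1%:M *t tau ->
  conditionally_unital (measure_prepare S).
Proof.
(* A one-dimensional [B] carries a single state, so the only input to test is uniform, and every
   outcome then has weight [a%:R^-1]. *)
move=> htau hS rho /density_dim1 ->; exists tau; split=> //.
transitivity (a%:R^-1 *: \sum_j S j).
  rewrite scaler_sumr; apply: eq_bigr => j _; congr (_ *: _).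
  case: (mxtens_indexP j) => i l.
  by rewrite tensmxE !mxE !eqxx mulr1n mulr1.
rewrite hS; apply/matrixP => r s; rewrite !mxE mulrA; congr (_ * _).
by rewrite mulr_natr.
Qed.

End MeasurePrepare.

(** * Separable states are majorized by the trivial state *)

Section SeparableStates.
Variable R : realType.
Local Notation C := R[i].

(* Dephasing in an orthonormal basis followed by this preparation is unital and
   sends the basis vector [0] to [X].  For [n = 0] the junk value [0^-1 = 0] is
   never prepared. *)
Definition prepare_or_complement n (X : 'M[C]_n.+1) (i : 'I_n.+1) :
    'M[C]_n.+1 :=
  if i == 0 then X else n%:R^-1 *: (1%:M - X).

Lemma density_prepare_or_complement n (X : 'M[C]_n.+1) i :
  density X -> density (prepare_or_complement X i).
Proof.
rewrite /prepare_or_complement; case: eqP => // /eqP i0 hX.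
(* A nonzero index in ['I_n.+1] forces [n > 0]; the trace of the complement is then
   [(n + 1) - 1 = n], which the factor normalizes. *)
have n0 : n%:R != 0 :> C.
  by rewrite pnatr_eq0; case: n i i0 {X hX} => // i; rewrite ord1.
split; first by apply: psdZ; [rewrite invr_ge0 ler0n | exact: psd_sub_density].
have [_ trX] := hX.
by rewrite linearZ linearB /= mxtrace1 trX -natr1 addrK mulVf.
Qed.

Lemma sum_prepare_or_complement n (X : 'M[C]_n.+1) :
  density X -> \sum_i prepare_or_complement X i = 1%:M.
Proof.
move=> hX; rewrite /prepare_or_complement big_ord_recl /= sumr_const card_ord.
rewrite -scaler_nat scalerA.
(* In dimension one no complement term occurs, and [X] is already the identity. *)
case: n X hX => [|n] X hX; first by rewrite mul0r scale0r addr0 (density_dim1 hX).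
by rewrite mulfV ?pnatr_eq0 // scale1r subrKC.
Qed.

Lemma tens_suml (I : finType) m n (F : I -> 'M[C]_m) (Y : 'M[C]_n) :
  (\sum_i F i) *t Y = \sum_i F i *t Y.
Proof.
apply/matrixP => r s; rewrite !(mxE, summxE) mulr_suml.
by apply: eq_bigr => i _; rewrite !mxE.
Qed.

Lemma tens_sumr (I : finType) m n (X : 'M[C]_m) (F : I -> 'M[C]_n) :
  X *t (\sum_i F i) = \sum_i X *t F i.
Proof.
apply/matrixP => r s; rewrite !(mxE, summxE) mulr_sumr.
by apply: eq_bigr => i _; rewrite !mxE.
Qed.

Lemma tensZr m n c (X : 'M[C]_m) (Y : 'M[C]_n) : X *t (c *: Y) = c *: (X *t Y).
Proof. by apply/matrixP => r s; rewrite !mxE mulrCA. Qed.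

Lemma isometric_channel_id n : isometric_channel (id : 'M[C]_n -> 'M[C]_n).
Proof.
exists 1%:M; rewrite trmx1 map_mx1 mulmx1; split=> // X.
by rewrite mul1mx mulmx1.
Qed.

Lemma act1_id n k (X : 'M[C]_(n * k)) : act1 id X = X.
Proof.
by apply/matrixP => i j; rewrite !mxE -!surjective_pairing !mxtens_unindexK.
Qed.

Lemma density_separable a b (rho : 'M[C]_(a * b)) :
  separable rho -> density rho.
Proof.
move=> [k [p [sigma [tau [p0 p1 hs ht ->]]]]].
by apply: density_mixture => // x; apply: density_tens.
Qed.

Lemma separable_dim_gt0 a b (rho : 'M[C]_(a * b)) : separable rho -> (0 < a)%N.
Proof. by move=> /density_separable/density_gt0; rewrite muln_gt0 => /andP[]. Qed.

Lemma trivial_majorizes_separable a b (rho : 'M[C]_(a * b)) :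
  separable rho -> cond_majorizes (1%:M : 'M[C]_(1 * 1)) rho.
Proof.
move=> sep; case: a rho sep (separable_dim_gt0 sep) => // a rho sep _.
case: sep => k [p [sigma [tau [p0 p1 hs ht rhoE]]]].
pose S (j : 'I_(a.+1 * 1)) := \sum_x (p x)%:C *:
  (prepare_or_complement (sigma x) (mxtens_unindex j).1 *t tau x).
(* The marginal of [rho] on [B], shared by all [S j] because the [A] factors prepared there have
   trace 1. *)
pose taubar := \sum_x (p x)%:C *: tau x.
pose e0 : 'cV[C]_a.+1 := delta_mx 0 0.
exists a.+1, (fun X => e0 *m X *m e0^t*), id, (measure_prepare S); split.
- by rewrite geq_max leqnn.
- exists e0; split=> //; rewrite trmx_delta map_delta_mx mul_delta_mx.
  by apply/matrixP => i j; rewrite !ord1 !mxE.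
- exact: isometric_channel_id.
- split.
  + apply: measure_prepare_channel => j; apply: density_mixture => // x.
    by apply: density_tens => //; apply: density_prepare_or_complement.
  + apply: (@measure_prepare_conditionally_unital _ _ _ _ taubar).
      exact: density_mixture.
    (* For each fixed [x], the [A] factors summed over all outcomes give the identity. *)
    rewrite exchange_big tens_sumr; apply: eq_bigr => x _.
    rewrite -scaler_sumr tensZr -(sum_prepare_or_complement (hs x)) tens_suml.
    congr (_ *: _); rewrite big_mxtens_index; apply: eq_bigr => i _.
    by rewrite big_ord1 mxtens_indexK.
  + apply: (@measure_prepare_semicausal _ a.+1 1 b S taubar) => j.
    rewrite linear_sum; apply: eq_bigr => x _.
    rewrite linearZ /= ptrace1_tens.
    have [_ ->] :=
      density_prepare_or_complement (mxtens_unindex j).1 (hs x).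
    by rewrite scale1r.
(* The embedded trivial state is the projector on [e0], so outcome 0 is certain and only [S] at 0,
   which is [rho], survives. *)
- have E i l : act1 (fun X => e0 *m X *m e0^t*) (1%:M : 'M[C]_(1 * 1))
      (mxtens_index (i, l)) (mxtens_index (i, l)) = (i == 0)%:R.
    rewrite mxE !mxtens_indexK /= [X in e0 *m X](_ : _ = 1%:M); last first.
      by apply/matrixP => s t; rewrite !ord1 !mxE eqxx.
    by rewrite mulmx1 trmx_delta map_delta_mx mul_delta_mx mxE andbb.
  rewrite act1_id rhoE /measure_prepare big_mxtens_index big_ord_recl.
  rewrite [X in _ + X]big1 => [|i _].
    rewrite big_ord1 E scale1r addr0; apply: eq_bigr => x _.
    by rewrite mxtens_indexK.
  by rewrite big_ord1 E scale0r.
Qed.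

Lemma cond_entropy_trivial (H : forall a b : nat, 'M[C]_(a * b) -> R) :
  quantum_cond_entropy H -> H 1%N 1%N (1%:M : 'M[C]_(1 * 1)) = 0.
Proof.
move=> hH.
have d1 : density (1%:M : 'M[C]_(1 * 1)) := density1 R.
have := qce_additive hH d1 d1.
(* Since [1 * 1] computes to [1], additivity relates values of [H] at the same dimensions; once the
   regrouped state is seen to be [1%:M], it reads [h = h + h]. *)
rewrite [X in H _ _ X = _](_ : _ = 1%:M).
  by move=> /eqP; rewrite -subr_eq0 opprD addrA subrr sub0r oppr_eq0 => /eqP.
rewrite -[X in X *t _](tens11 R 1 1) -[X in _ *t X](tens11 R 1 1).
by rewrite regroup_tens !tens11.
Qed.

End SeparableStates.

Theorem mainTheorem3 (R : realType) (a b : nat) (rho : 'M[R[i]]_(a * b))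
    (hrho : separable rho)
    (H : forall a b : nat, 'M[R[i]]_(a * b) -> R)
    (hH : quantum_cond_entropy H) :
  0 <= H a b rho.
Proof.
rewrite -(cond_entropy_trivial hH); apply: (qce_monotone hH).
- exact: (density1 R).
- exact: density_separable.
- exact: trivial_majorizes_separable.
Qed.
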